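(* Let $\alpha>1$, $\delta\in(0,\alpha-1)$, $\tau\in(0,\alpha-1-\delta]$, $d\in\mathbb N$, $1\ge\gamma_1\ge\dots\ge\gamma_d>0$, and $g\in\mathcal A_{\alpha,\boldsymbol\gamma,d}$. Let $\boldsymbol x_1,\dots,\boldsymbol x_N\in[0,1]^d$, $c_1,\dots,c_N\in\mathbb R$. Let $L$ be a prime and $\mathcal Z=\{\boldsymbol z_0,\dots,\boldsymbol z_{L-1}\}$ a rank-1 lattice point set of size $L$ satisfying $e(H_{\beta,\boldsymbol\gamma,d},\mathcal Z)\le C_{\boldsymbol\gamma,d}(\beta,\tau')L^{-\beta+\tau'}$ for all $\tau'\in(0,\beta-\frac12]$, where $\beta=\alpha-\frac12-\delta$. Then for $m\in\mathbb N$, with $K=Q^\alpha_{m,\boldsymbol\gamma,d}$, $$\Big|\frac1N\sum_{n=1}^Nc_ng(\boldsymbol x_n)-\frac1L\sum_{\ell=0}^{L-1}g(\boldsymbol z_\ell)\phi_K(\boldsymbol z_\ell)\Big|\le\mathrm{err}_1(g,\mathcal C)+\mathrm{err}_2(g,\mathcal C)\le\|g\|_{\mathcal A_{\alpha,\boldsymbol\gamma,d}}\Big[\frac1{\sqrt{2^{m-d+1}}}+\frac{\sqrt{2^m}}{L^{\alpha-\frac12-\delta-\tau}}c_{\alpha,\boldsymbol\gamma,d}\,\zeta_{\delta,d}\,C_{\boldsymbol\gamma,d}\big(\alpha-\tfrac12-\delta,\tau\big)\Big]\overline\mu_N.$$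
   Context: $r_\beta(\gamma,h)=\max(|h|^{2\beta}/\gamma,1)$, $r_\beta(\boldsymbol\gamma,\boldsymbol k)=\prod_jr_\beta(\gamma_j,k_j)$; $\omega_{\boldsymbol k}(\boldsymbol x)=\exp(2\pi i\,\boldsymbol k\cdot\boldsymbol x)$, $\widehat f_{\boldsymbol k}=\int_{[0,1]^d}f\,\overline{\omega_{\boldsymbol k}}$. $\mathcal A_{\alpha,\boldsymbol\gamma,d}=\{f\in L_1([0,1]^d):\|f\|_{\mathcal A_{\alpha,\boldsymbol\gamma,d}}=\sum_{\boldsymbol k}\sqrt{r_\alpha(\boldsymbol\gamma,\boldsymbol k)}|\widehat f_{\boldsymbol k}|<\infty\}$; $H_{\beta,\boldsymbol\gamma,d}=\{f\in L_2:\|f\|^2_{H_{\beta,\boldsymbol\gamma,d}}=\sum_{\boldsymbol k}r_\beta(\boldsymbol\gamma,\boldsymbol k)|\widehat f_{\boldsymbol k}|^2<\infty\}$. Weighted step hyperbolic cross: $Q^\alpha_{m,\boldsymbol\gamma,d}=\bigcup_{\boldsymbol t\in\mathbb N_0^d,\|\boldsymbol t\|_1=m}\{\boldsymbol k\in\mathbb Z^d:r_\alpha(\gamma_j,k_j)\le2^{t_j}\ \forall j\}$. $\phi_K(\boldsymbol x)=\sum_{\boldsymbol k\in K}\check\phi_{\boldsymbol k}\overline{\omega_{\boldsymbol k}(\boldsymbol x)}$, $\check\phi_{\boldsymbol k}=\frac1N\sum_nc_n\omega_{\boldsymbol k}(\boldsymbol x_n)$; $\mathcal C=(c_n)$; $\mathrm{err}_1(g,\mathcal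 C)=|\frac1N\sum_nc_ng(\boldsymbol x_n)-\int g\phi_K|$, $\mathrm{err}_2(g,\mathcal C)=|\int g\phi_K-\frac1L\sum_\ell(g\phi_K)(\boldsymbol z_\ell)|$. Rank-1 lattice: $\{\boldsymbol z_\ell=(\ell\mathfrak g/L)\bmod1\}$, $\mathfrak g\in\{1,\dots,L-1\}^d$. $e(H_{\beta,\boldsymbol\gamma,d},\mathcal Z)=\sup_{\|f\|\le1}|\int f-\frac1L\sum_\ell f(\boldsymbol z_\ell)|$. $C_{\boldsymbol\gamma,d}(\beta,\tau)=2^{\beta-\tau}\prod_j[1+2\gamma_j^{1/(2(\beta-\tau))}\zeta(\frac\beta{\beta-\tau})]^{\beta-\tau}$; $\overline\mu_N=\frac1N\sum_n|c_n|$; $c_{\alpha,\boldsymbol\gamma,d}=\sqrt{\prod_j\max(1,2^{2\alpha}\gamma_j)}$; $\zeta_{\delta,d}=[1+2\zeta(1+2\delta)]^{d/2}$; $\zeta$ Riemann zeta. *)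

(* Defs.v *)
From HB Require Import structures.
From mathcomp Require Import all_boot all_order all_algebra.
From mathcomp Require Import all_classical all_reals all_analysis.
From mathcomp Require Import complex.
Set Implicit Arguments. Unset Strict Implicit. Unset Printing Implicit Defensive.
Import Order.TTheory GRing.Theory Num.Theory.
Import numFieldNormedType.Exports.
Local Open Scope classical_set_scope.
Local Open Scope ring_scope.

Section Defs.
Variable R : realType.
Local Notation C := (R[i]).

Definition cabs (z : C) : R := Num.sqrt (complex.Re z ^+ 2 + complex.Im z ^+ 2).

(* points of R^d are d-tuples (with the product sigma-algebra of MathComp-Analysis);
   frequencies are d-tuples of integers *)

Definition cube (d : nat) : set (d.-tuple R) :=
  [set x | forall i : 'I_d, 0 <= tnth x i <= 1].

(* Lebesgue integral over [0,1]^d, computed as an iterated integral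
   (by Fubini this is the integral w.r.t. d-dimensional Lebesgue measure
   for integrable functions) *)
Fixpoint cint (n : nat) : (n.-tuple R -> R) -> R :=
  match n return (n.-tuple R -> R) -> R with
  | 0 => fun f => f [tuple]
  | n'.+1 => fun f =>
      Rintegral (@lebesgue_measure R) `[0%R, 1%R]
        (fun t => cint (fun y : n'.-tuple R => f [tuple of t :: y]))
  end.

(* iterated integral of nonnegative (extended) functions; by Tonelli it is the
   integral w.r.t. d-dimensional Lebesgue measure for measurable functions *)
Fixpoint ecint (n : nat) : (n.-tuple R -> \bar R) -> \bar R :=
  match n return (n.-tuple R -> \bar R) -> \bar R with
  | 0 => fun f => f [tuple]
  | n'.+1 => fun f =>
      (\int[@lebesgue_measure R]_(t in `[0%R, 1%R])
        ecint (fun y : n'.-tuple R => f [tuple of t :: y]))%E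
  end.

Definition cintC (d : nat) (f : d.-tuple R -> C) : C :=
  (cint (fun x => complex.Re (f x)) +i* cint (fun x => complex.Im (f x)))%C.

Definition in_Lp (p : nat) (d : nat) (f : d.-tuple R -> C) : Prop :=
  measurable_fun (@cube d) (fun x => complex.Re (f x)) /\
  measurable_fun (@cube d) (fun x => complex.Im (f x)) /\
  (@ecint d (fun x => ((cabs (f x)) ^+ p)%:E) < +oo)%E.

Definition dotkx (d : nat) (k : d.-tuple int) (x : d.-tuple R) : R :=
  \sum_(i < d) (tnth k i)%:~R * tnth x i.

Definition omega (d : nat) (k : d.-tuple int) (x : d.-tuple R) : C :=
  (cos (2 * pi * dotkx k x) +i* sin (2 * pi * dotkx k x))%C.
Definition omegabar (d : nat) (k : d.-tuple int) (x : d.-tuple R) : C :=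
  (cos (2 * pi * dotkx k x) +i* - sin (2 * pi * dotkx k x))%C.

Definition fhat (d : nat) (f : d.-tuple R -> C) (k : d.-tuple int) : C :=
  cintC (fun x => f x * omegabar k x).

Definition r1 (beta gam : R) (h : int) : R :=
  Num.max ((`|h|%:~R `^ (2 * beta)) / gam) 1.
Definition rw (d : nat) (beta : R) (gam : 'I_d -> R) (k : d.-tuple int) : R :=
  \prod_(j < d) r1 beta (gam j) (tnth k j).

Definition boxpt (d M : nat) (j : {ffun 'I_d -> 'I_(2 * M + 1)}) : d.-tuple int :=
  [tuple (j i)%:Z - M%:Z | i < d].

(* f coincides pointwise on [0,1]^d with (the limit of the square partial sums
   of) its Fourier series: f is identified with its continuous representative *)
Definition fourier_rep (d : nat) (f : d.-tuple R -> C) : Prop :=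
  forall x, @cube d x ->
    (fun M : nat => complex.Re (\sum_(j : {ffun 'I_d -> 'I_(2 * M + 1)})
                          fhat f (boxpt j) * omega (boxpt j) x))
      @ \oo --> complex.Re (f x) /\
    (fun M : nat => complex.Im (\sum_(j : {ffun 'I_d -> 'I_(2 * M + 1)})
                          fhat f (boxpt j) * omega (boxpt j) x))
      @ \oo --> complex.Im (f x).

Definition normA (d : nat) (alpha : R) (gam : 'I_d -> R) (f : d.-tuple R -> C)
  : \bar R :=
  \esum_(k in [set: d.-tuple int]) (Num.sqrt (rw alpha gam k) * cabs (fhat f k))%:E.

Definition inA (d : nat) (alpha : R) (gam : 'I_d -> R) (f : d.-tuple R -> C) : Prop :=
  in_Lp 1 f /\ (normA alpha gam f < +oo)%E.

Definition normH2 (d : nat) (beta : R) (gam : 'I_d -> R) (f : d.-tuple R -> C)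
  : \bar R :=
  \esum_(k in [set: d.-tuple int]) (rw beta gam k * (cabs (fhat f k)) ^+ 2)%:E.

(* unit ball of H_{beta,gamma,d} (functions taken as their continuous representative) *)
Definition unitH (d : nat) (beta : R) (gam : 'I_d -> R) (f : d.-tuple R -> C) : Prop :=
  in_Lp 2 f /\ (normH2 beta gam f <= 1)%E /\ fourier_rep f.

Definition lattice_pt (d L : nat) (gv : 'I_d -> nat) (l : nat) : d.-tuple R :=
  [tuple ((l * gv i) %% L)%:R / L%:R | i < d].

Definition lattice_rule (d L : nat) (gv : 'I_d -> nat) (f : d.-tuple R -> C) : C :=
  (L%:R)^-1 * \sum_(l < L) f (lattice_pt L gv l).

Definition wce (d : nat) (beta : R) (gam : 'I_d -> R) (L : nat) (gv : 'I_d -> nat)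
  : \bar R :=
  ereal_sup [set (cabs (cintC f - lattice_rule L gv f))%:E
            | f in [set f | unitH beta gam f]].

Definition Qcross (d : nat) (alpha : R) (gam : 'I_d -> R) (m : nat)
  : set (d.-tuple int) :=
  [set k | exists t : 'I_d -> nat, (\sum_(j < d) t j)%N = m /\
           forall j : 'I_d, r1 alpha (gam j) (tnth k j) <= 2 ^+ (t j)].

Definition phicheck (d N : nat) (X : 'I_N -> d.-tuple R) (c : 'I_N -> R)
  (k : d.-tuple int) : C :=
  (N%:R)^-1 * \sum_(n < N) ((c n)%:C)%C * omega k (X n).

Definition phiK (d N : nat) (X : 'I_N -> d.-tuple R) (c : 'I_N -> R)
  (K : set (d.-tuple int)) (x : d.-tuple R) : C :=
  \sum_(k \in K) phicheck X c k * omegabar k x.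

Definition err1 (d N : nat) (X : 'I_N -> d.-tuple R) (c : 'I_N -> R)
  (K : set (d.-tuple int)) (g : d.-tuple R -> C) : R :=
  cabs ((N%:R)^-1 * \sum_(n < N) ((c n)%:C)%C * g (X n)
         - cintC (fun x => g x * phiK X c K x)).
Definition err2 (d N : nat) (X : 'I_N -> d.-tuple R) (c : 'I_N -> R)
  (K : set (d.-tuple int)) (g : d.-tuple R -> C) (L : nat) (gv : 'I_d -> nat) : R :=
  cabs (cintC (fun x => g x * phiK X c K x)
         - lattice_rule L gv (fun x => g x * phiK X c K x)).

(* Riemann zeta function (for s > 1) *)
Definition zeta (s : R) : R := limn (fun n => \sum_(1 <= k < n) ((k%:R : R) `^ (- s))).

Definition Cgd (d : nat) (gam : 'I_d -> R) (beta tau : R) : R :=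
  2 `^ (beta - tau) *
  \prod_(j < d) (1 + 2 * gam j `^ ((2 * (beta - tau))^-1)
                     * zeta (beta / (beta - tau))) `^ (beta - tau).

Definition cagd (d : nat) (alpha : R) (gam : 'I_d -> R) : R :=
  Num.sqrt (\prod_(j < d) Num.max 1 (2 `^ (2 * alpha) * gam j)).

Definition zetadd (delta : R) (d : nat) : R :=
  (1 + 2 * zeta (1 + 2 * delta)) `^ (d%:R / 2).

Definition muN (N : nat) (c : 'I_N -> R) : R := (N%:R)^-1 * \sum_(n < N) `|c n|.

End Defs.

Arguments cube {R} d _.
Arguments lattice_pt {R d} L gv l.

(* Main.v *)
(* Write a_k for the Fourier coefficients of g. Since sum |a_k| is finite, g is
   on the cube the uniform limit of its Fourier sums, hence uniformly continuous
   and bounded, and the iterated integral is linear on such functions; this alone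
   gives int g phi_K = sum_(k in K) phicheck_k a_k and
   (g phi_K)^_k = sum_(h in K) phicheck_h a_(k+h).

   err1 is therefore the tail of sum_k a_k phicheck_k outside the hyperbolic
   cross, where r_alpha(k) >= 2^(m-d+1).

   err2 is at most the worst-case error times the norm of g phi_K in H_beta. By
   the Cauchy-Schwarz inequality with weights w_k = r_alpha(k)^(1/2),
     (sum_(h in K) |a_(k+h)|)^2 <= ||g||_A * sum_(h in K) |a_(k+h)| / w_(k+h),
   and r_beta(k) <= c^2 r_alpha(k+h) r_beta(h) turns the sum over k back into
   ||g||_A; it remains to bound sum_(h in K) r_beta(h), using
   r_beta(h) <= r_alpha(h) prod_j max(1,|h_j|)^-(1+2delta) and r_alpha <= 2^m on
   K. *)
Require Import Defs.
From HB Require Import structures.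
From mathcomp Require Import all_boot all_order all_algebra.
From mathcomp Require Import all_classical all_reals all_analysis.
From mathcomp Require Import complex.
From mathcomp Require Import measurable_realfun ring lra zify.
Set Implicit Arguments. Unset Strict Implicit. Unset Printing Implicit Defensive.
Import Order.TTheory GRing.Theory Num.Theory.
Import numFieldNormedType.Exports.
Local Open Scope classical_set_scope.
Local Open Scope ring_scope.

(** * Modulus and convergence in the complex numbers *)

Section ComplexModulus.
Variable R : realType.
Implicit Types z w : R[i].

Lemma cabsE z : cabs z = Normc.normc z. Proof. by case: z. Qed.

Lemma cabs_ge0 z : 0 <= cabs z. Proof. exact: sqrtr_ge0. Qed.

Lemma cabs0 : cabs (0 : R[i]) = 0. Proof. by rewrite cabsE Normc.normc0. Qed.

Lemma cabsM z w : cabs (z * w) = cabs z * cabs w.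
Proof. by rewrite !cabsE Normc.normcM. Qed.

Lemma cabsN z : cabs (- z) = cabs z.
Proof. by rewrite !cabsE (normcN (z : Rcomplex R)). Qed.

Lemma cabsD z w : cabs (z + w) <= cabs z + cabs w.
Proof. by rewrite !cabsE (le_normcD (z : Rcomplex R)). Qed.

Lemma cabs_sum I (s : seq I) (P : pred I) (F : I -> R[i]) :
  cabs (\sum_(i <- s | P i) F i) <= \sum_(i <- s | P i) cabs (F i).
Proof.
elim/big_ind2 : _ => [|x y z w xy zw|//]; first by rewrite cabs0.
by rewrite (le_trans (cabsD _ _))// lerD.
Qed.

Lemma cabs_real (a : R) : cabs (a%:C)%C = `|a|.
Proof. by rewrite /cabs /= expr0n addr0 sqrtr_sqr. Qed.

Lemma cabs_nat n : cabs (n%:R : R[i]) = n%:R.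
Proof.
rewrite [n%:R in LHS](_ : _ = ((n%:R : R)%:C)%C); last by rewrite rmorph_nat.
by rewrite cabs_real ger0_norm.
Qed.

Lemma cabsV z : cabs z^-1 = (cabs z)^-1.
Proof. by rewrite !cabsE Normc.normcV. Qed.

Lemma sqr_cabs z : cabs z ^+ 2 = complex.Re z ^+ 2 + complex.Im z ^+ 2.
Proof. by rewrite sqr_sqrtr// addr_ge0// sqr_ge0. Qed.

Lemma Re_le_cabs z : `|complex.Re z| <= cabs z.
Proof.
by rewrite -sqrtr_sqr ler_wsqrtr// lerDl sqr_ge0.
Qed.

Lemma Im_le_cabs z : `|complex.Im z| <= cabs z.
Proof.
by rewrite -sqrtr_sqr ler_wsqrtr// lerDr sqr_ge0.
Qed.

Lemma cabs_le_ReIm z : cabs z <= `|complex.Re z| + `|complex.Im z|.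
Proof.
rewrite -[leRHS]ger0_norm ?addr_ge0// -sqrtr_sqr ler_wsqrtr//.
rewrite sqrrD !real_normK ?num_real// -addrA [X in _ <= _ + X]addrC addrA lerDl.
by rewrite mulrn_wge0// mulr_ge0.
Qed.

Lemma complex_ReM z w : complex.Re (z * w) =
  complex.Re z * complex.Re w - complex.Im z * complex.Im w.
Proof. by case: z; case: w. Qed.

Lemma complex_ImM z w : complex.Im (z * w) =
  complex.Re z * complex.Im w + complex.Im z * complex.Re w.
Proof. by case: z; case: w. Qed.

(** Convergence by real and imaginary parts is the form in which [fourier_rep] is stated;
    [cvgC_cabs] translates it to the modulus. *)
Definition cvgC (u : nat -> R[i]) (l : R[i]) : Prop :=
  (fun n => complex.Re (u n)) @ \oo --> complex.Re l /\
  (fun n => complex.Im (u n)) @ \oo --> complex.Im l.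

Lemma cvgC_cabs (u : nat -> R[i]) l :
  cvgC u l <-> (fun n => cabs (u n - l)) @ \oo --> 0.
Proof.
split=> [[ur ui]|/cvgrPdist_le ul].
- apply/cvgrPdist_le => e e0.
  have e2 : 0 < e / 2 by rewrite divr_gt0.
  move/cvgrPdist_le : ur => /(_ _ e2) ur; move/cvgrPdist_le : ui => /(_ _ e2) ui.
  near=> n.
  rewrite sub0r normrN ger0_norm ?cabs_ge0//.
  rewrite (le_trans (cabs_le_ReIm _))// [e]splitr !raddfB /=.
  by rewrite lerD// distrC; near: n.
- split; apply/cvgrPdist_le => e /ul; apply: filterS => n;
    rewrite sub0r normrN ger0_norm ?cabs_ge0//; apply: le_trans;
    rewrite distrC -raddfB; [exact: Re_le_cabs|exact: Im_le_cabs].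
Unshelve. all: by end_near. Qed.

Lemma cvgCD u v l m : cvgC u l -> cvgC v m ->
  cvgC (fun n => u n + v n) (l + m).
Proof.
by move=> [u1 u2] [v1 v2]; split;
  under eq_fun do rewrite raddfD; rewrite raddfD; exact: cvgD.
Qed.

Lemma cvgCZ u l a : cvgC u l -> cvgC (fun n => a * u n) (a * l).
Proof.
move=> [u1 u2]; split.
- under eq_fun do rewrite complex_ReM; rewrite complex_ReM.
  by apply: cvgB; apply: cvgM => //; exact: cvg_cst.
- under eq_fun do rewrite complex_ImM; rewrite complex_ImM.
  by apply: cvgD; apply: cvgM => //; exact: cvg_cst.
Qed.

Lemma cvgC_cst a : cvgC (fun=> a) a.
Proof. by split; exact: cvg_cst. Qed.

Lemma cvgC_sum I (s : seq I) (u : I -> nat -> R[i]) l :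
  (forall i, cvgC (u i) (l i)) ->
  cvgC (fun n => \sum_(i <- s) u i n) (\sum_(i <- s) l i).
Proof.
move=> ul; elim: s => [|i s ih].
  by under eq_fun do rewrite big_nil; rewrite big_nil; exact: cvgC_cst.
by under eq_fun do rewrite big_cons; rewrite big_cons; exact: cvgCD.
Qed.

Lemma cvgC_cabs_le u l B : cvgC u l -> (\forall n \near \oo, cabs (u n) <= B) ->
  cabs l <= B.
Proof.
move=> /cvgC_cabs ul uB; apply/ler_addgt0Pr => e e0.
move/cvgrPdist_le : ul => /(_ _ e0) ul.
have [n [un uen]] := filter_ex (filterI uB ul).
rewrite (_ : l = u n + - (u n - l)); last by rewrite opprB addrC subrK.
rewrite (le_trans (cabsD _ _))// lerD// cabsN.
by move: uen; rewrite sub0r normrN ger0_norm// cabs_ge0.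
Qed.
End ComplexModulus.

(** * Bounded uniformly continuous functions on the cube and their iterated integral *)

Section CubeIntegral.
Variable R : realType.

(** Uniform continuity is taken in the sup distance and only on the cube. Boundedness is part of the
    definition, so closure under products needs no compactness argument. *)
Definition bucont d (f : d.-tuple R -> R) : Prop :=
  (exists M, forall x, cube d x -> `|f x| <= M) /\
  forall e, 0 < e -> exists2 h, 0 < h & forall x y, cube d x -> cube d y ->
    (forall i, `|tnth x i - tnth y i| < h) -> `|f x - f y| <= e.

Section Closure.
Variable d : nat.
Implicit Types f g : d.-tuple R -> R.

Lemma bucont_cst a : bucont (fun _ : d.-tuple R => a).
Proof.
split; first by exists `|a|.
by move=> e e0; exists 1 => // x y *; rewrite subrr normr0 ltW.
Qed.

Lemma bucontD f g : bucont f -> bucont g -> bucont (fun x => f x + g x).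
Proof.
move=> [[M fM] fu] [[N gN] gu]; split.
  by exists (M + N) => x cx; rewrite (le_trans (ler_normD _ _))// lerD ?fM ?gN.
move=> e e0; have e2 : 0 < e / 2 by rewrite divr_gt0.
have [h1 h10 H1] := fu _ e2; have [h2 h20 H2] := gu _ e2.
exists (Num.min h1 h2) => [|x y cx cy xy]; first by rewrite lt_min h10.
rewrite [X in `|X|](_ : _ = (f x - f y) + (g x - g y)); last by ring.
rewrite (le_trans (ler_normD _ _))// [e]splitr lerD//.
  by apply: H1 => // i; move: (xy i); rewrite lt_min => /andP[].
by apply: H2 => // i; move: (xy i); rewrite lt_min => /andP[].
Qed.

Lemma bucontM f g : bucont f -> bucont g -> bucont (fun x => f x * g x).
Proof.
move=> [[M fM] fu] [[N gN] gu].
have {}fM x : cube d x -> `|f x| <= `|M| + 1.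
  by move=> /fM /le_trans; apply; rewrite (le_trans (ler_norm _))// lerDl.
have {}gN x : cube d x -> `|g x| <= `|N| + 1.
  by move=> /gN /le_trans; apply; rewrite (le_trans (ler_norm _))// lerDl.
split.
  by exists ((`|M| + 1) * (`|N| + 1)) => x cx; rewrite normrM ler_pM ?fM ?gN.
move=> e e0.
have e1 : 0 < e / 2 / (`|N| + 1) by rewrite !divr_gt0// ltr_wpDl.
have e2 : 0 < e / 2 / (`|M| + 1) by rewrite !divr_gt0// ltr_wpDl.
have [h1 h10 H1] := fu _ e1; have [h2 h20 H2] := gu _ e2.
exists (Num.min h1 h2) => [|x y cx cy xy]; first by rewrite lt_min h10.
rewrite [X in `|X|](_ : _ = (f x - f y) * g x + f y * (g x - g y)); last by ring.
rewrite (le_trans (ler_normD _ _))// [e]splitr lerD// normrM.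
  rewrite -[leRHS](@divfK _ (`|N| + 1)) ?gt_eqF ?ltr_wpDl// ler_pM ?gN//.
  by apply: H1 => // i; move: (xy i); rewrite lt_min => /andP[].
rewrite mulrC -[leRHS](@divfK _ (`|M| + 1)) ?gt_eqF ?ltr_wpDl// ler_pM ?fM//.
by apply: H2 => // i; move: (xy i); rewrite lt_min => /andP[].
Qed.

Lemma bucontZ a f : bucont f -> bucont (fun x => a * f x).
Proof. exact/bucontM/bucont_cst. Qed.

Lemma bucontN f : bucont f -> bucont (fun x => - f x).
Proof.
by move=> /(bucontZ (-1)); congr bucont; apply: funext => x; rewrite mulN1r.
Qed.

Lemma bucontB f g : bucont f -> bucont g -> bucont (fun x => f x - g x).
Proof. by move=> bf /bucontN; exact: bucontD. Qed.

Lemma bucont_sum I (s : seq I) (F : I -> d.-tuple R -> R) :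
  (forall i, bucont (F i)) -> bucont (fun x => \sum_(i <- s) F i x).
Proof.
move=> bF; elim: s => [|i s ih].
  by under eq_fun do rewrite big_nil; exact: bucont_cst.
by under eq_fun do rewrite big_cons; exact: bucontD.
Qed.

(** Three-epsilon argument; it is through this closure property that [g], a uniform limit of
    trigonometric polynomials, becomes integrable by sections. *)
Lemma bucont_unif_lim f :
  (forall e, 0 < e -> exists2 g, bucont g &
     forall x, cube d x -> `|f x - g x| <= e) -> bucont f.
Proof.
move=> fl; split.
  have [g [[M gM] _] fg] := fl _ ltr01.
  exists (1 + M) => x cx; rewrite -[f x](subrK (g x)).
  by rewrite (le_trans (ler_normD _ _))// lerD ?fg ?gM.
move=> e e0; have e3 : 0 < e / 3 by rewrite divr_gt0.
have [g [_ gu] fg] := fl _ e3; have [h h0 H] := gu _ e3.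
exists h => // x y cx cy xy.
have := fg _ cx; have := fg _ cy; have := H _ _ cx cy xy.
by rewrite !ler_norml => /andP[? ?] /andP[? ?] /andP[? ?]; apply/andP; split; lra.
Qed.

Lemma bucont_tnth i : bucont (fun x : d.-tuple R => tnth x i).
Proof.
split; first by exists 1 => x /(_ i) /andP[x0 x1]; rewrite ger0_norm.
by move=> e e0; exists e => // x y _ _ xy; exact: ltW.
Qed.

Lemma bucont_comp_lip f (u : R -> R) : (forall x, `|u x| <= 1) ->
  (forall x y, `|u x - u y| <= `|x - y|) -> bucont f -> bucont (u \o f).
Proof.
move=> u1 ul [_ fu]; split; first by exists 1 => x _; exact: u1.
move=> e /fu [h h0 H]; exists h => // x y cx cy xy.
by rewrite (le_trans (ul _ _))// H.
Qed.

Lemma bucont_dotkx (k : d.-tuple int) : bucont (dotkx k).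
Proof. by apply: bucont_sum => i; apply: bucontZ; exact: bucont_tnth. Qed.

End Closure.

Lemma lip_of_derive (u du : R -> R) : (forall x, is_derive x (1:R) u (du x)) ->
  (forall x, `|du x| <= 1) -> forall x y, `|u x - u y| <= `|x - y|.
Proof.
move=> dU du1.
suff H x y : x < y -> `|u y - u x| <= `|y - x|.
  move=> x y; have [xy|xy|->] := ltgtP x y; last by rewrite !subrr.
    by rewrite distrC [leRHS]distrC H.
  exact: H.
move=> xy; have [|c _ ->] := @MVT R u du x y xy (fun z _ => dU z).
  apply: derivable_within_continuous => z _.
  by have [] := dU z.
by rewrite normrM ler_piMl.
Qed.

Lemma cos_lip (x y : R) : `|cos x - cos y| <= `|x - y|.
Proof.
apply: (@lip_of_derive cos (fun x => - sin x)) => z.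
by rewrite normrN ler_norml sin_geN1 sin_le1.
Qed.

Lemma sin_lip (x y : R) : `|sin x - sin y| <= `|x - y|.
Proof.
apply: (@lip_of_derive sin cos) => z.
by rewrite ler_norml cos_geN1 cos_le1.
Qed.

Lemma bucont_cos d (k : d.-tuple int) :
  bucont (fun x => cos (2 * pi * dotkx k x)).
Proof.
apply: (@bucont_comp_lip _ (fun x => 2 * pi * dotkx k x) cos).
- by move=> x; rewrite ler_norml cos_geN1 cos_le1.
- exact: cos_lip.
- exact/bucontZ/bucont_dotkx.
Qed.

Lemma bucont_sin d (k : d.-tuple int) :
  bucont (fun x => sin (2 * pi * dotkx k x)).
Proof.
apply: (@bucont_comp_lip _ (fun x => 2 * pi * dotkx k x) sin).
- by move=> x; rewrite ler_norml sin_geN1 sin_le1.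
- exact: sin_lip.
- exact/bucontZ/bucont_dotkx.
Qed.

Lemma cube_cons d t (x : d.-tuple R) : 0 <= t <= 1 -> cube d x ->
  cube d.+1 [tuple of t :: x].
Proof.
move=> t01 cx i; case: (unliftP ord0 i) => [j ->|->]; last by rewrite tnth0.
by rewrite tnthS.
Qed.

Lemma bucont_section d (f : d.+1.-tuple R -> R) t : 0 <= t <= 1 ->
  bucont f -> bucont (fun x : d.-tuple R => f [tuple of t :: x]).
Proof.
move=> t01 [[M fM] fu]; split.
  by exists M => x cx; apply: fM; exact: cube_cons.
move=> e e0; have [h h0 H] := fu _ e0; exists h => // x y cx cy xy.
apply: H => [||i]; [exact: cube_cons..|].
case: (unliftP ord0 i) => [j ->|->]; first by rewrite !tnthS.
by rewrite !tnth0 subrr normr0.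
Qed.

Lemma unif_cont_integrable (F : R -> R) :
  (forall e, 0 < e -> exists2 h, 0 < h & forall s t, 0 <= s <= 1 ->
     0 <= t <= 1 -> `|s - t| < h -> `|F s - F t| <= e) ->
  (@lebesgue_measure R).-integrable `[0, 1] (EFin \o F).
Proof.
move=> FU; apply: continuous_compact_integrable; first exact: segment_compact.
apply/subspace_continuousP => x; rewrite /= in_itv /= => x01.
apply/cvgrPdist_le => e /FU [h h0 H].
rewrite near_withinE; near=> t => /=; rewrite in_itv /= => t01.
apply: H => //; near: t.
Unshelve. all: by end_near. Qed.

Definition cint_linear_bounded d : Prop :=
  [/\ forall f g : d.-tuple R -> R, bucont f -> bucont g ->
        cint (fun x => f x + g x) = cint f + cint g,
      forall a (f : d.-tuple R -> R), bucont f ->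
        cint (fun x => a * f x) = a * cint f &
      forall (f : d.-tuple R -> R) M, bucont f ->
        (forall x, cube d x -> `|f x| <= M) -> `|cint f| <= M].

Lemma integrable_cint_section d (f : d.+1.-tuple R -> R) :
  cint_linear_bounded d -> bucont f ->
  (@lebesgue_measure R).-integrable `[0, 1]
    (EFin \o (fun t => cint (fun y : d.-tuple R => f [tuple of t :: y]))).
Proof.
move=> [ihD ihZ ihM] bf; apply: unif_cont_integrable => e e0.
have [_ /(_ _ e0)[h h0 H]] := bf; exists h => // s t s01 t01 st.
(* The subtracted integral is written as -1 times an integral, so that the two linearity clauses
   merge both into one integral of a difference, small by uniform continuity in the first
   coordinate. *)
rewrite -[X in _ - X]mul1r -mulNr -ihZ; last exact: bucont_section.
rewrite -ihD; [|exact: bucont_section|exact/bucontZ/bucont_section].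
apply: ihM => [|x cx].
  by apply: bucontD; [|apply: bucontZ]; exact: bucont_section.
rewrite mulN1r; apply: H => [||i]; [exact: cube_cons..|].
case: (unliftP ord0 i) => [j ->|->]; last by rewrite !tnth0.
by rewrite !tnthS subrr normr0.
Qed.

(* Linearity and the sup bound go through the induction together: the bound
   makes the partial integrals uniformly continuous, hence integrable. *)
Lemma cintP d : cint_linear_bounded d.
Proof.
elim: d => [|d ih]; first by split => //= f M _; apply => -[].
have sect := integrable_cint_section ih; have [ihD ihZ ihM] := ih.
have in01 (t : R) : t \in `[0, 1]%classic -> 0 <= t <= 1.
  by rewrite inE /= in_itv.
split=> [f g bf bg|a f bf|f M bf fM] /=.
- rewrite -RintegralD//; [|exact: sect..].
  apply: eq_Rintegral => t /in01 t01; apply: ihD; exact: bucont_section.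
- rewrite -RintegralZl//; last exact: sect.
  apply: eq_Rintegral => t /in01 t01; apply: ihZ; exact: bucont_section.
- apply: le_trans (le_normr_Rintegral _ (sect _ bf)) _ => //.
  (* The interval has length 1, so [M] is its own integral and the bound reduces to monotonicity. *)
  have -> : M = \int[@lebesgue_measure R]_(t in `[0, 1]) M.
    rewrite Rintegral_cst// [X in fine X]lebesgue_measure_itv/= lte_fin ltr01.
    by rewrite sube0 mulr1.
  apply: le_Rintegral => //.
  + exact: integrable_norm (sect _ bf).
  + apply: unif_cont_integrable => e e0; exists 1 => // s t _ _ _.
    by rewrite subrr normr0 ltW.
  + move=> t /mem_set/in01 t01; apply: ihM; first exact: bucont_section.
    by move=> x cx; apply: fM; exact: cube_cons.
Qed.

Lemma cintD d (f g : d.-tuple R -> R) : bucont f -> bucont g ->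
  cint (fun x => f x + g x) = cint f + cint g.
Proof. by have [H _ _] := cintP d; exact: H. Qed.

Lemma cintZ d a (f : d.-tuple R -> R) : bucont f ->
  cint (fun x => a * f x) = a * cint f.
Proof. by have [_ H _] := cintP d; exact: H. Qed.

(** This turns the extended-valued integral of [in_Lp] into a real number, which makes it finite;
    integrability of the partial integrals justifies [fineK] at each level. *)
Lemma ecint_cint d (f : d.-tuple R -> R) : bucont f ->
  ecint (fun x => (f x)%:E) = (cint f)%:E.
Proof.
elim: d => [//|d ih] in f * => bf /=.
rewrite /Rintegral fineK; last first.
  by apply: integrable_fin_num => //; exact: integrable_cint_section (cintP d) _.
apply: eq_integral => t; rewrite inE /= in_itv /= => t01.
by apply: ih; exact: bucont_section.
Qed.

End CubeIntegral.

(** * The integral of complex-valued functions on the cube *)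

Section ComplexCubeIntegral.
Variables (R : realType) (d : nat).
Implicit Types f g : d.-tuple R -> R[i].

Definition bucontC f : Prop :=
  bucont (fun x => complex.Re (f x)) /\ bucont (fun x => complex.Im (f x)).

Lemma bucontC_cst a : bucontC (fun _ => a).
Proof. by split; exact: bucont_cst. Qed.

Lemma bucontCD f g : bucontC f -> bucontC g -> bucontC (fun x => f x + g x).
Proof.
by move=> [f1 f2] [g1 g2]; split; under eq_fun do rewrite raddfD; exact: bucontD.
Qed.

Lemma bucontCM f g : bucontC f -> bucontC g -> bucontC (fun x => f x * g x).
Proof.
move=> [f1 f2] [g1 g2]; split.
- by under eq_fun do rewrite complex_ReM; apply: bucontB; exact: bucontM.
- by under eq_fun do rewrite complex_ImM; apply: bucontD; exact: bucontM.
Qed.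

Lemma bucontC_sum I (s : seq I) (F : I -> d.-tuple R -> R[i]) :
  (forall i, bucontC (F i)) -> bucontC (fun x => \sum_(i <- s) F i x).
Proof.
move=> bF; elim: s => [|i s ih].
  by under eq_fun do rewrite big_nil; exact: bucontC_cst.
by under eq_fun do rewrite big_cons; exact: bucontCD.
Qed.

Lemma bucontC_unif_lim f :
  (forall e, 0 < e -> exists2 g, bucontC g &
     forall x, cube d x -> cabs (f x - g x) <= e) -> bucontC f.
Proof.
move=> fl; split; apply: bucont_unif_lim => e /fl [g [g1 g2] fg].
- exists (fun x => complex.Re (g x)) => // x /fg; apply: le_trans.
  by rewrite -raddfB Re_le_cabs.
- exists (fun x => complex.Im (g x)) => // x /fg; apply: le_trans.
  by rewrite -raddfB Im_le_cabs.
Qed.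

Lemma bucontC_omega (k : d.-tuple int) : bucontC (omega k).
Proof. by split; [exact: bucont_cos|exact: bucont_sin]. Qed.

Lemma bucontC_omegabar (k : d.-tuple int) : bucontC (omegabar k).
Proof. by split; [exact: bucont_cos|exact/bucontN/bucont_sin]. Qed.

Lemma bucont_sqr_cabs f : bucontC f -> bucont (fun x => cabs (f x) ^+ 2).
Proof.
move=> [f1 f2]; under eq_fun do rewrite sqr_cabs !expr2.
by apply: bucontD; exact: bucontM.
Qed.

Lemma cintCD f g : bucontC f -> bucontC g ->
  cintC (fun x => f x + g x) = cintC f + cintC g.
Proof.
move=> [f1 f2] [g1 g2]; rewrite /cintC.
under eq_fun do rewrite raddfD.
under [X in (_ +i* cint X)%C]eq_fun do rewrite raddfD.
by rewrite !cintD.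
Qed.

Lemma cintCZ a f : bucontC f -> cintC (fun x => a * f x) = a * cintC f.
Proof.
move=> [f1 f2]; rewrite /cintC.
under eq_fun do rewrite complex_ReM -mulNr.
under [X in (_ +i* cint X)%C]eq_fun do rewrite complex_ImM.
rewrite !cintD ?cintZ//; [|exact: bucontZ..].
by apply/eqP; rewrite eq_complex complex_ReM complex_ImM /= mulNr !eqxx.
Qed.

Lemma cintC0 : cintC (fun _ : d.-tuple R => 0) = 0.
Proof.
rewrite -[RHS](mul0r (cintC (fun _ : d.-tuple R => 0))) -cintCZ.
  by congr cintC; apply: funext => x; rewrite mul0r.
exact: bucontC_cst.
Qed.

Lemma cintC_sum I (s : seq I) (F : I -> d.-tuple R -> R[i]) :
  (forall i, bucontC (F i)) ->
  cintC (fun x => \sum_(i <- s) F i x) = \sum_(i <- s) cintC (F i).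
Proof.
move=> bF; elim: s => [|i s ih].
  by rewrite big_nil; under eq_fun do rewrite big_nil; exact: cintC0.
rewrite big_cons -ih -cintCD//; last exact: bucontC_sum.
by congr cintC; apply: funext => x; rewrite big_cons.
Qed.

End ComplexCubeIntegral.

(** * Characters, translation of frequencies, and boxes of frequencies *)

Section Frequencies.
Variables (R : realType) (d : nat).
Implicit Types k h : d.-tuple int.

Definition addk k h : d.-tuple int := [tuple tnth k i + tnth h i | i < d].

Lemma tnth_addk k h i : tnth (addk k h) i = tnth k i + tnth h i.
Proof. by rewrite tnth_mktuple. Qed.

Lemma addkI h : injective (addk^~ h).
Proof.
move=> k1 k2 eqk; apply: eq_from_tnth => i.
by apply: (addIr (tnth h i)); rewrite -!tnth_addk eqk.
Qed.

Lemma dotkx_addk k h (x : d.-tuple R) :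
  dotkx (addk k h) x = dotkx k x + dotkx h x.
Proof.
rewrite /dotkx -big_split; apply: eq_bigr => i _ /=.
by rewrite tnth_addk intrD mulrDl.
Qed.

Lemma omegabarM k h (x : d.-tuple R) :
  omegabar k x * omegabar h x = omegabar (addk k h) x.
Proof.
rewrite /omegabar dotkx_addk (mulrDr (2 * pi)) cosD sinD; apply/eqP.
by rewrite eq_complex; apply/andP; split; apply/eqP => /=; ring.
Qed.

(** Needed to regroup the Fourier sums of a product with a trigonometric polynomial into translated
    Fourier sums of [g]. *)
Lemma omega_addkM k h (x : d.-tuple R) :
  omega (addk k h) x * omegabar h x = omega k x.
Proof.
rewrite /omegabar /omega dotkx_addk (mulrDr (2 * pi)) cosD sinD; apply/eqP.
have := cos2Dsin2 (2 * pi * dotkx h x).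
set c := cos _; set s := sin _ => cs.
rewrite eq_complex /=; apply/andP; split; apply/eqP.
  by rewrite -[RHS]mulr1 -cs; ring.
by rewrite -[RHS]mulr1 -cs; ring.
Qed.

Lemma cabs_omega k (x : d.-tuple R) : cabs (omega k x) = 1.
Proof. by rewrite /cabs /= cos2Dsin2 sqrtr1. Qed.

(** These are the frequencies with all coordinates between -M and M, the index set of the square
    partial sums in [fourier_rep]. As a duplicate-free list it can be compared by inclusion with any
    other finite set of frequencies. *)
Definition box (M : nat) : seq (d.-tuple int) :=
  [seq boxpt j | j : {ffun 'I_d -> 'I_(2 * M + 1)}].

Lemma big_box (T : nmodType) M (F : d.-tuple int -> T) :
  \sum_(j : {ffun 'I_d -> 'I_(2 * M + 1)}) F (boxpt j) = \sum_(k <- box M) F k.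
Proof. by rewrite big_image. Qed.

Lemma box_uniq M : uniq (box M).
Proof.
rewrite map_inj_uniq ?enum_uniq// => j1 j2 /(congr1 (fun t => tnth t)) e.
apply/ffunP => i; apply: val_inj.
by have := congr1 (fun u => u i) e; rewrite !tnth_mktuple => /addIr [].
Qed.

Lemma mem_box M k : (k \in box M) = [forall i, `|tnth k i|%N <= M]%N.
Proof.
apply/mapP/forallP => [[j _ -> i]|kM].
  by rewrite tnth_mktuple; case: (j i) => n nM /=; lia.
(* The index representing k_i is k_i + M, which is nonnegative here, so [absz] only changes its
   type. *)
have ltk i : (absz (tnth k i + M%:Z)%R < 2 * M + 1)%N by have := kM i; lia.
exists [ffun i => Ordinal (ltk i)]; first by rewrite mem_enum.
apply: eq_from_tnth => i; rewrite tnth_mktuple ffunE /=.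
by have := kM i; lia.
Qed.

Lemma box_sub M1 M2 : (M1 <= M2)%N -> {subset box M1 <= box M2}.
Proof.
move=> M12 k; rewrite !mem_box => /forallP kM; apply/forallP => i.
exact: leq_trans (kM i) M12.
Qed.

Lemma seq_sub_box (s : seq (d.-tuple int)) : exists M, {subset s <= box M}.
Proof.
exists (\max_(k <- s) \max_(i < d) `|tnth k i|%N)%N => k ks.
rewrite mem_box; apply/forallP => i.
apply: (@leq_trans (\max_(i < d) `|tnth k i|%N)%N).
  exact: (@leq_bigmax _ (fun i => `|tnth k i|%N) i).
exact: (@leq_bigmax_seq _ s xpredT (fun k => \max_(i < d) `|tnth k i|%N)%N).
Qed.

End Frequencies.

(** * Finite sums over nested lists and tails of summable families *)

Section SubsetSums.
Variable T : eqType.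
Implicit Types s t : seq T.

Lemma sum_subset (V : nmodType) s t (F : T -> V) :
  uniq s -> uniq t -> {subset s <= t} ->
  \sum_(i <- t) F i = \sum_(i <- s) F i + \sum_(i <- t | i \notin s) F i.
Proof.
move=> us ut st; rewrite (bigID (mem s)) /= -big_filter; congr (_ + _).
apply: perm_big; apply: uniq_perm => //; first exact: filter_uniq.
by move=> i; rewrite mem_filter; case: (boolP (i \in s)) => //= /st.
Qed.

Lemma ler_sum_subset (R : numDomainType) s t (F : T -> R) :
  uniq s -> uniq t -> {subset s <= t} -> (forall i, 0 <= F i) ->
  \sum_(i <- s) F i <= \sum_(i <- t) F i.
Proof.
by move=> us ut st F0; rewrite (sum_subset F us ut st) lerDl sumr_ge0.
Qed.

End SubsetSums.

(** A finite sum within e of the supremum of all finite sums is enclosed in a box; a larger set can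
    then add at most e. *)
Lemma summable_tail (R : realType) (d : nat) (F : d.-tuple int -> R) (A e : R) :
  (forall k, 0 <= F k) ->
  (forall s, uniq s -> \sum_(k <- s) F k <= A) -> 0 < e ->
  exists M, forall t, uniq t -> {subset box d M <= t} ->
    \sum_(k <- t | k \notin box d M) F k <= e.
Proof.
move=> F0 FA e0.
pose S := [set \sum_(k <- s) F k | s in [set s | uniq s]].
have supS : has_sup S.
  split; first by exists (\sum_(k <- [::]) F k), [::].
  by exists A => _ [s us <-]; exact: FA.
have [_ [s us <-] sS] := sup_adherent e0 supS.
have [M sM] := seq_sub_box s; exists M => t ut Mt.
have tS : \sum_(k <- t) F k <= sup S by apply: sup_upper_bound => //; exists t.
have := ler_sum_subset us (box_uniq d M) sM F0.
by move: tS sS; rewrite (sum_subset F (box_uniq d M) ut Mt); lra.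
Qed.

(** * Functions with absolutely convergent Fourier series and their products with trigonometric
    polynomials *)

Section AbsolutelyConvergentFourierSeries.
Variables (R : realType) (d : nat) (g : d.-tuple R -> R[i]) (A : R).
Hypothesis gA : forall s : seq (d.-tuple int), uniq s ->
  \sum_(k <- s) cabs (fhat g k) <= A.
Hypothesis gF : fourier_rep g.

Definition fsum (s : seq (d.-tuple int)) x : R[i] :=
  \sum_(k <- s) fhat g k * omega k x.

Lemma fsum_box_cvg x : cube d x -> cvgC (fun M => fsum (box d M) x) (g x).
Proof.
move=> /gF [g1 g2].
have E M := big_box M (fun k => fhat g k * omega k x).
by split; under eq_fun do rewrite /fsum -E.
Qed.

(** Both [fsum t] and [g], the latter as a limit over larger boxes, lie within e/2 of the sum over
    one box. All finite supersets of the box are allowed for [t], because translated boxes occur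
    below. *)
Lemma fsum_close e : 0 < e -> exists M, forall t, uniq t ->
  {subset box d M <= t} -> forall x, cube d x -> cabs (g x - fsum t x) <= e.
Proof.
move=> e0; have e2 : 0 < e / 2 by rewrite divr_gt0.
have [M HM] := summable_tail (fun k => cabs_ge0 (fhat g k)) gA e2.
have near_box t x : uniq t -> {subset box d M <= t} ->
    cabs (fsum t x - fsum (box d M) x) <= e / 2.
  move=> ut Mt; rewrite /fsum (sum_subset _ (box_uniq d M) ut Mt) addrAC subrr add0r.
  rewrite (le_trans (cabs_sum _ _ _))//.
  by under eq_bigr do rewrite cabsM cabs_omega mulr1; exact: HM.
exists M => t ut Mt x cx.
rewrite -(subrK (fsum (box d M) x) (g x)) -addrA (le_trans (cabsD _ _))//.
rewrite [e]splitr lerD//; last first.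
  by rewrite -opprB cabsN; exact: near_box.
have H := cvgCD (fsum_box_cvg cx) (cvgC_cst (- fsum (box d M) x)).
apply: cvgC_cabs_le H _; near=> M'.
apply: near_box; first exact: box_uniq.
by apply: box_sub; near: M'; exact: nbhs_infty_ge.
Unshelve. all: by end_near. Qed.

Lemma fsum_cvg (t : nat -> seq (d.-tuple int)) x : cube d x ->
  (forall n, uniq (t n)) ->
  (forall M, \forall n \near \oo, {subset box d M <= t n}) ->
  cvgC (fun n => fsum (t n) x) (g x).
Proof.
move=> cx ut tM; apply/cvgC_cabs; apply/cvgrPdist_le => e e0.
have [M HM] := fsum_close e0.
apply: filterS (tM M) => n Mt.
by rewrite sub0r normrN ger0_norm ?cabs_ge0// -opprB cabsN; exact: HM.
Qed.

Lemma bucontC_Fourier : bucontC g.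
Proof.
apply: bucontC_unif_lim => e /fsum_close [M HM].
exists (fsum (box d M)).
  apply: bucontC_sum => k; apply: bucontCM; first exact: bucontC_cst.
  exact: bucontC_omega.
by apply: HM => //; exact: box_uniq.
Qed.

Section TrigonometricMultiplier.
Variables (s : seq (d.-tuple int)) (p : d.-tuple int -> R[i]).

Let phi x := \sum_(h <- s) p h * omegabar h x.

Let bucontC_term h k :
  bucontC (fun x => g x * omegabar h x * omegabar k x).
Proof.
by apply: bucontCM; [apply: bucontCM; [exact: bucontC_Fourier|]|];
  exact: bucontC_omegabar.
Qed.

Let mul_phiE x : g x * phi x = \sum_(h <- s) p h * (g x * omegabar h x).
Proof. by rewrite mulr_sumr; apply: eq_bigr => h _; rewrite mulrCA. Qed.

Lemma cintC_mul_trig :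
  cintC (fun x => g x * phi x) = \sum_(h <- s) p h * fhat g h.
Proof.
have bg h : bucontC (fun x => g x * omegabar h x).
  by apply: bucontCM; [exact: bucontC_Fourier|exact: bucontC_omegabar].
under eq_fun do rewrite mul_phiE.
rewrite cintC_sum => [|h]; last by apply: bucontCM => //; exact: bucontC_cst.
by apply: eq_bigr => h _; rewrite cintCZ.
Qed.

Lemma fhat_mul_trig k :
  fhat (fun x => g x * phi x) k = \sum_(h <- s) p h * fhat g (addk k h).
Proof.
rewrite /fhat.
under eq_fun do rewrite mul_phiE mulr_suml.
under eq_fun do under eq_bigr do rewrite -mulrA.
rewrite cintC_sum => [|h]; last by apply: bucontCM => //; exact: bucontC_cst.
apply: eq_bigr => h _; rewrite cintCZ//; congr (_ * cintC _).
by apply: funext => x; rewrite -mulrA [X in _ * X = _]mulrC omegabarM.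
Qed.

(** A square partial sum for the product is a finite combination of Fourier sums of [g] over boxes
    translated by h. These still exhaust all frequencies, so [fsum_cvg] applies to each. *)
Lemma fourier_rep_mul_trig : fourier_rep (fun x => g x * phi x).
Proof.
move=> x cx.
suff: cvgC (fun M => \sum_(k <- box d M)
    fhat (fun x => g x * phi x) k * omega k x) (g x * phi x).
  have E M := big_box M (fun k => fhat (fun x => g x * phi x) k * omega k x).
  by move=> [H1 H2]; split; under eq_fun do rewrite E.
have -> : (fun M => \sum_(k <- box d M)
    fhat (fun x => g x * phi x) k * omega k x) =
    (fun M => \sum_(h <- s) p h * omegabar h x *
       fsum [seq addk k h | k <- box d M] x).
  apply: funext => M; under eq_bigr do rewrite fhat_mul_trig mulr_suml.
  rewrite exchange_big; apply: eq_bigr => h _.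
  rewrite /fsum mulr_sumr [RHS]big_map; apply: eq_bigr => k _.
  by rewrite -(omega_addkM k h x); ring.
rewrite mul_phiE.
have -> : \sum_(h <- s) p h * (g x * omegabar h x) =
    \sum_(h <- s) p h * omegabar h x * g x.
  by apply: eq_bigr => h _; ring.
apply: cvgC_sum => h; apply: cvgCZ; apply: fsum_cvg => // [n|M].
  by rewrite map_inj_uniq ?box_uniq//; exact: addkI.
(* If Mh bounds the coordinates of h, the box of radius M lies in the translate by h of the box of
   radius n once n >= M + Mh. *)
have [Mh hM] := seq_sub_box [:: h].
near=> n => k; rewrite mem_box => /forallP kM.
pose k' : d.-tuple int := [tuple tnth k i - tnth h i | i < d].
apply/mapP; exists k'; last first.
  by apply: eq_from_tnth => i; rewrite tnth_addk tnth_mktuple subrK.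
have : h \in box d Mh by apply: hM; rewrite inE.
have nM : (M + Mh <= n)%N by near: n; exact: nbhs_infty_ge.
rewrite !mem_box => /forallP hMh; apply/forallP => i; rewrite tnth_mktuple.
have := kM i; have := hMh i.
by move: (tnth k i) (tnth h i) nM => u v; lia.
Unshelve. all: by end_near. Qed.

Lemma bucontC_mul_trig : bucontC (fun x => g x * phi x).
Proof.
apply: bucontCM; first exact: bucontC_Fourier.
apply: bucontC_sum => h; apply: bucontCM; first exact: bucontC_cst.
exact: bucontC_omegabar.
Qed.

(** Measurability comes from the parts of [g] and from the coordinate projections inside cosine and
    sine; finiteness of the square integral comes from [ecint_cint]. *)
Lemma in_L2_mul_trig : measurable_fun (cube d) (fun x => complex.Re (g x)) ->
  measurable_fun (cube d) (fun x => complex.Im (g x)) ->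
  in_Lp 2 (fun x => g x * phi x).
Proof.
move=> mg1 mg2.
have mdot k : measurable_fun (cube d) (fun x : d.-tuple R => 2 * pi * dotkx k x).
  apply: measurable_funM => //; apply: measurable_sum => i.
  by apply: measurable_funM => //; apply: measurable_funTS; exact: measurable_tnth.
have mcos k : measurable_fun (cube d) (fun x : d.-tuple R => cos (2 * pi * dotkx k x)).
  apply: measurableT_comp => //; apply: continuous_measurable_fun.
  exact: continuous_cos.
have msin k : measurable_fun (cube d) (fun x : d.-tuple R => sin (2 * pi * dotkx k x)).
  apply: measurableT_comp => //; apply: continuous_measurable_fun.
  exact: continuous_sin.
have mphi1 : measurable_fun (cube d) (fun x => complex.Re (phi x)).
  under eq_fun do rewrite raddf_sum /=.
  apply: measurable_sum => h; under eq_fun do rewrite complex_ReM /=.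
  by apply: measurable_funB; apply: measurable_funM => //; exact: measurableT_comp.
have mphi2 : measurable_fun (cube d) (fun x => complex.Im (phi x)).
  under eq_fun do rewrite raddf_sum /=.
  apply: measurable_sum => h; under eq_fun do rewrite complex_ImM /=.
  by apply: measurable_funD; apply: measurable_funM => //; exact: measurableT_comp.
split; [|split].
- under eq_fun do rewrite complex_ReM.
  by apply: measurable_funB; exact: measurable_funM.
- under eq_fun do rewrite complex_ImM.
  by apply: measurable_funD; exact: measurable_funM.
- by rewrite ecint_cint ?ltry//; exact/bucont_sqr_cabs/bucontC_mul_trig.
Qed.

End TrigonometricMultiplier.
End AbsolutelyConvergentFourierSeries.

(** * Bounds by the Riemann zeta function *)

Section Zeta.
Variables (R : realType) (s : R).
Hypothesis s1 : 1 < s.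

Let u n : R := \sum_(1 <= k < n) (k%:R : R) `^ (- s).

Let u_nd : nondecreasing_seq u.
Proof.
apply/nondecreasing_seqP => -[|n]; first by rewrite /u !big_geq.
by rewrite /u [leRHS]big_nat_recr//= lerDl powR_ge0.
Qed.

Let q : R := 2 `^ (1 - s).

Let q01 : 0 < q < 1.
Proof.
rewrite /q powR_gt0//= -[ltRHS](powRr0 2) /powR !ifF ?gt_eqF//.
by rewrite ltr_expR mul0r pmulr_llt0 ?ln_gt0 ?ltr1n// subr_lt0.
Qed.

(* Cauchy condensation. *)
Let u_geometric n : u (2 ^ n)%N <= \sum_(i < n) q ^+ i.
Proof.
elim: n => [|n ih]; first by rewrite big_ord0 /u big_geq.
rewrite big_ord_recr /= /u (@big_cat_nat _ _ _ (2 ^ n)) //=; last 2 first.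
- by rewrite expn_gt0.
- by rewrite leq_exp2l.
apply: lerD => //.
(* The dyadic block has 2^n terms, each at most (2^n)^(-s), and 2^n (2^n)^(-s) = q^n. *)
have -> : q ^+ n = \sum_(2 ^ n <= k < 2 ^ n.+1) ((2 ^ n)%N%:R : R) `^ (- s).
  rewrite sumr_const_nat expnS mul2n -addnn addnK -powR_mulrn; last first.
    by case/andP: q01 => /ltW.
  rewrite /q -powRrM -[RHS]mulr_natl.
  rewrite natrX -powR_mulrn// -powRrM.
  by rewrite -powRD ?pnatr_eq0 ?implybT//; congr (_ `^ _); ring.
apply: ler_sum_nat => k /andP[nk _].
rewrite !powRN lef_pV2 ?posrE ?powR_gt0 ?ltr0n ?expn_gt0//.
  apply: ge0_ler_powR; rewrite ?nnegrE ?ler0n ?ler_nat//.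
  exact: le_trans (ltW s1).
by apply: leq_trans nk; rewrite expn_gt0.
Qed.

(** Since [zeta] is a [limn], convergence has to be established first: the partial sums increase and
    are bounded by the geometric series 1/(1-q), using k <= 2^k to pass to dyadic indices. *)
Lemma zeta_partial_le n : \sum_(1 <= k < n) (k%:R : R) `^ (- s) <= zeta s.
Proof.
apply: (nondecreasing_cvgn_le u_nd).
apply: nondecreasing_is_cvgn => //; exists ((1 - q)^-1) => _ [k _ <-].
have k2 : (k <= 2 ^ k)%N by rewrite ltnW// ltn_expl.
apply: le_trans (u_nd k2) (le_trans (u_geometric k) _).
have [q0 q1] := andP q01.
have := subrX1 q k; rewrite -opprB => /eqP; rewrite eqr_oppLR => /eqP E.
rewrite -[leRHS]mul1r ler_pdivlMr ?subr_gt0// mulrC.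
have : (1 - q) * (\sum_(i < k) q ^+ i) = 1 - q ^+ k.
  by rewrite -opprB mulNr -subrX1 opprB.
by move=> ->; rewrite gerBl exprn_ge0// ltW.
Qed.

Lemma zeta_ge0 : 0 <= zeta s.
Proof. by have := zeta_partial_le 0; rewrite big_geq. Qed.

(** This is max(1,|h|)^(-s), with the value at 0 given separately. *)
Definition zeta_weight (h : int) : R :=
  if h == 0 then 1 else `|h|%:~R `^ (- s).

Lemma zeta_weight_ge0 h : 0 <= zeta_weight h.
Proof. by rewrite /zeta_weight; case: ifP => // _; exact: powR_ge0. Qed.

Lemma zeta_weightN h : zeta_weight (- h) = zeta_weight h.
Proof. by rewrite /zeta_weight oppr_eq0 normrN. Qed.

(** Passing from M to M + 1 adds the two end frequencies, each contributing the next term of the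
    zeta series. The upper limit in [u] is exclusive, so [u M.+1] runs over 1..M. *)
Lemma sum_zeta_weight M :
  \sum_(j < 2 * M + 1) zeta_weight (j%:Z - M%:Z) <= 1 + 2 * zeta s.
Proof.
apply: (@le_trans _ _ (1 + 2 * u M.+1)); last first.
  by rewrite lerD2l ler_wpM2l// zeta_partial_le.
rewrite -(big_mkord xpredT (fun j => zeta_weight (j%:Z - M%:Z))).
elim: M => [|M ih].
  by rewrite big_nat1 /u big_geq// mulr0 !addr0 /zeta_weight eqxx.
have -> : (2 * M.+1 + 1 = (2 * M + 1).+2)%N by lia.
rewrite big_nat_recl// big_nat_recr//= /u big_nat_recr//= -/(u M.+1).
have -> : \sum_(0 <= i < 2 * M + 1) zeta_weight (i.+1%:Z - M.+1%:Z) =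
          \sum_(0 <= i < 2 * M + 1) zeta_weight (i%:Z - M%:Z).
  by apply: eq_bigr => i _; congr zeta_weight; lia.
have -> : 0%N%:Z - M.+1%:Z = - M.+1%:Z by rewrite sub0r.
have -> : (2 * M + 1).+1%:Z - M.+1%:Z = M.+1%:Z by lia.
rewrite zeta_weightN; have -> : zeta_weight M.+1 = M.+1%:R `^ (- s).
  by rewrite /zeta_weight /= ger0_norm.
by move: ih; lra.
Qed.

(** After enlarging [t] to a box, the sum of products factors into d equal one-dimensional sums. *)
Lemma sum_prod_zeta_weight d (t : seq (d.-tuple int)) : uniq t ->
  \sum_(k <- t) \prod_(i < d) zeta_weight (tnth k i) <= (1 + 2 * zeta s) ^+ d.
Proof.
move=> ut; have [M tM] := seq_sub_box t.
apply: le_trans (ler_sum_subset ut (box_uniq d M) tM _) _.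
  by move=> k; apply: prodr_ge0 => i _; exact: zeta_weight_ge0.
rewrite -(big_box M (fun k => \prod_(i < d) zeta_weight (tnth k i))).
under eq_bigr do under eq_bigr do rewrite tnth_mktuple.
rewrite -(bigA_distr_bigA (fun (i : 'I_d) (j : 'I_(2 * M + 1)) =>
  zeta_weight (j%:Z - M%:Z))) prodr_const card_ord.
by rewrite lerXn2r ?nnegrE ?sum_zeta_weight// ?addr_ge0 ?mulr_ge0 ?zeta_ge0//
  sumr_ge0// => j _; exact: zeta_weight_ge0.
Qed.

End Zeta.

(** * One-dimensional weights of two smoothness orders *)

Lemma intr_norm_ge1 (R : realType) (h : int) : h != 0 -> 1 <= `|h|%:~R :> R.
Proof. by move=> h0; rewrite -[1]/(1%:~R) ler_int; lia. Qed.

Section Weights.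
Variables (R : realType) (alpha beta : R).
Hypotheses (b0 : 0 < beta) (ba : beta <= alpha).

Lemma r1_ge1 b gam h : 1 <= r1 b gam h :> R.
Proof. by rewrite le_max lexx orbT. Qed.

Lemma r1_ge0 b gam h : 0 <= r1 b gam h :> R.
Proof. exact: le_trans (r1_ge1 _ _ _). Qed.

Lemma r1_ge b gam h : `|h|%:~R `^ (2 * b) / gam <= r1 b gam h :> R.
Proof. by rewrite le_max lexx. Qed.

Variable gam : R.
Hypothesis gam01 : 0 < gam <= 1.

Let g0 : 0 < gam. Proof. by case/andP: gam01. Qed.

Lemma r1_mono h : r1 beta gam h <= r1 alpha gam h.
Proof.
(* At h = 0 the powers vanish because both exponents are nonzero ([powR] gives 1 at exponent 0);
   otherwise |h| >= 1 and the power increases with the exponent. *)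
have [->|h0] := eqVneq h 0.
  by rewrite /r1 normr0 !powR0 ?mulf_neq0 ?pnatr_eq0 ?gt_eqF// (lt_le_trans b0).
rewrite ge_max r1_ge1 andbT (le_trans _ (r1_ge _ _ _))//.
rewrite ler_pM2r ?invr_gt0// ler_powR ?intr_norm_ge1//.
by rewrite ler_wpM2l.
Qed.

(** For nonzero integers k+h and h, |k| <= |k+h| + |h| <= 2|k+h||h|. Raising this to the power 2
    beta and dividing by gamma leaves the factor 2^(2 beta) gamma, which the maximum absorbs. The
    last inequality fails when h or k+h is 0, so these cases are separate. *)
Lemma r1_shift (k h : int) : r1 beta gam k <=
  Num.max 1 (2 `^ (2 * alpha) * gam) * r1 alpha gam (k + h) * r1 beta gam h.
Proof.
set c := Num.max _ _.
have c1 : 1 <= c by rewrite le_max lexx.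
have c0 : 0 <= c by exact: le_trans c1.
have P1 : 1 <= c * r1 alpha gam (k + h).
  by rewrite -[leLHS]mulr1 ler_pM// r1_ge1.
have [->|h0] := eqVneq h 0.
  rewrite addr0 (le_trans (r1_mono k))//.
  rewrite (@le_trans _ _ (c * r1 alpha gam k))// ?ler_peMl ?ler_peMr ?r1_ge0 ?r1_ge1//.
  by rewrite mulr_ge0 ?r1_ge0.
have [kh|kh] := eqVneq (k + h) 0.
  have kE : k = - h by lia.
  have -> : r1 beta gam k = r1 beta gam h by rewrite /r1 kE normrN.
  by rewrite ler_peMl ?r1_ge0.
rewrite ge_max; apply/andP; split; last by rewrite -[leLHS]mulr1 ler_pM// r1_ge1.
apply: (@le_trans _ _ ((2 `^ (2 * beta) * gam) *
  (`|k + h|%:~R `^ (2 * beta) / gam) * (`|h|%:~R `^ (2 * beta) / gam))); last first.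
  have p0 (x : R) : 0 <= x `^ (2 * beta) / gam by rewrite divr_ge0 ?powR_ge0// ltW.
  have X0 : 0 <= 2 `^ (2 * beta) * gam by rewrite mulr_ge0 ?powR_ge0// ltW.
  have X1 : 2 `^ (2 * beta) * gam <= c.
    rewrite le_max; apply/orP; right.
    by rewrite ler_pM2r// ler_powR ?ler1n// ler_wpM2l.
  have Y1 := le_trans (r1_ge beta gam (k + h)) (r1_mono (k + h)).
  apply: ler_pM; [exact: mulr_ge0|exact: p0| |exact: r1_ge].
  by apply: ler_pM.
have -> : 2 `^ (2 * beta) * gam * (`|k + h|%:~R `^ (2 * beta) / gam) *
    (`|h|%:~R `^ (2 * beta) / gam) =
    (2 * `|k + h|%:~R * `|h|%:~R) `^ (2 * beta) / gam.
  rewrite !powRM ?mulr_ge0 ?ler0z//; field; exact: lt0r_neq0.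
rewrite ler_pM2r ?invr_gt0//; apply: ge0_ler_powR; rewrite ?nnegrE ?mulr_ge0 ?ler0z//.
  exact: ltW.
rewrite -[2]/(2%:~R) -!intrM ler_int.
have : (1 <= `|k + h|)%R by lia.
have : (1 <= `|h|)%R by lia.
have : (`|k| <= `|k + h| + `|h|)%R by lia.
by move: `|k|%R `|k + h|%R `|h|%R => x y z; nia.
Qed.

(** For h nonzero, gamma <= 1 makes the power the larger entry of the maximum in [r1 beta], and
    |h|^(2 beta) splits as |h|^(2 alpha) |h|^(-2(alpha-beta)). *)
Lemma r1_decay h :
  r1 beta gam h <= r1 alpha gam h * zeta_weight (2 * (alpha - beta)) h.
Proof.
rewrite /zeta_weight; case: eqVneq => [_|h0]; first by rewrite mulr1 r1_mono.
have n1 := intr_norm_ge1 R h0.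
have n0 : 0 < `|h|%:~R :> R by exact: lt_le_trans n1.
have -> : r1 beta gam h = `|h|%:~R `^ (2 * alpha) / gam *
    `|h|%:~R `^ (- (2 * (alpha - beta))).
  rewrite mulrAC -powRD; last by rewrite (gt_eqF n0) implybT.
  rewrite (_ : _ + _ = 2 * beta); last by ring.
  rewrite /r1; apply/max_idPl.
  rewrite ler_pdivlMr// mul1r (le_trans _ (_ : 1 <= _))//; first by case/andP: gam01.
  by rewrite -[leLHS](powRr0 `|h|%:~R) ler_powR// mulr_ge0// ltW.
by rewrite ler_wpM2r ?powR_ge0// r1_ge.
Qed.

End Weights.

(** * Product weights and the hyperbolic cross *)

Lemma ex_dyadic_ceil (R : realType) (r : R) : 1 <= r ->
  exists t : nat, r <= 2 ^+ t < 2 * r.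
Proof.
move=> r1.
have ex : exists n, r <= 2 ^+ n.
  exists (Num.bound r); apply: ltW; apply: lt_le_trans (archi_boundP _) _.
    exact: le_trans r1.
  by rewrite -natrX ler_nat ltnW// ltn_expl.
(* For the least exponent, 2^(t+1) >= 2r would already make t admissible; at exponent 0 the bound 1
   < 2r follows from r >= 1. *)
exists (ex_minn ex); case: ex_minnP => -[|t] rt tmin.
  by rewrite rt expr0; lra.
rewrite rt exprS ltr_pM2l// ltNge; apply/negP => /tmin.
by rewrite ltnn.
Qed.

Section ProductWeights.
Variables (R : realType) (d : nat) (gam : 'I_d -> R).
Hypothesis gam01 : forall j, 0 < gam j <= 1.
Implicit Types k h : d.-tuple int.

Lemma rw_ge1 b k : 1 <= rw b gam k.
Proof.
by apply: (big_ind (fun x : R => 1 <= x)) => // [x y x1 y1|i _];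
  [rewrite -[leLHS]mulr1 ler_pM|exact: r1_ge1].
Qed.

Lemma rw_ge0 b k : 0 <= rw b gam k.
Proof. exact: le_trans (rw_ge1 b k). Qed.

Section TwoSmoothness.
Variables alpha beta : R.
Hypotheses (b0 : 0 < beta) (ba : beta <= alpha).

Lemma rw_shift k h : rw beta gam k <=
  cagd alpha gam ^+ 2 * rw alpha gam (addk k h) * rw beta gam h.
Proof.
rewrite /cagd sqr_sqrtr; last first.
  by apply: prodr_ge0 => i _; rewrite le_max ler01.
rewrite /rw -!big_split /=; apply: ler_prod => i _.
by rewrite r1_ge0 tnth_addk r1_shift.
Qed.

Lemma rw_decay k : rw beta gam k <=
  rw alpha gam k * \prod_(i < d) zeta_weight (2 * (alpha - beta)) (tnth k i).
Proof.
rewrite /rw -big_split /=; apply: ler_prod => i _.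
by rewrite r1_ge0 r1_decay.
Qed.

End TwoSmoothness.

Section HyperbolicCross.
Variables (alpha : R) (m : nat).
Hypothesis alpha1 : 1 < alpha.

Lemma Qcross_rw_le k : Qcross alpha gam m k -> rw alpha gam k <= 2 ^+ m.
Proof.
move=> [t [<- kt]]; rewrite expr_sum; apply: ler_prod => i _.
by rewrite r1_ge0 kt.
Qed.

(** Serves only to make the cross finite: |k_i| <= |k_i|^(2 alpha) <= |k_i|^(2 alpha) / gamma_i <=
    2^(t_i) <= 2^m for k_i nonzero. *)
Lemma Qcross_sub_box k : Qcross alpha gam m k -> k \in box d (2 ^ m)%N.
Proof.
move=> [t [tm kt]]; rewrite mem_box; apply/forallP => i.
have [->|k0] := eqVneq (tnth k i) 0; first by rewrite absz0.
have n1 := intr_norm_ge1 R k0.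
have [g0 g1] := andP (gam01 i).
rewrite -lez_nat abszE -(ler_int R).
apply: le_trans (_ : (2 : R) ^+ t i <= _); last first.
  by rewrite -tm -natrX ler_nat leq_exp2l// (bigD1 i)//= leq_addr.
apply: le_trans (le_trans (r1_ge alpha (gam i) (tnth k i)) (kt i)).
apply: (@le_trans _ _ (`|tnth k i|%:~R `^ (2 * alpha))).
  rewrite -[leLHS]powRr1 ?(le_trans ler01 n1)// ler_powR//.
  by move: alpha1; lra.
by rewrite ler_peMr ?powR_ge0// invf_ge1.
Qed.

Lemma finite_Qcross : finite_set (Qcross alpha gam m).
Proof.
apply: (@sub_finite_set _ _ [set` box d (2 ^ m)%N]) => //.
by move=> k /Qcross_sub_box.
Qed.

(* Rounding each factor r_j up to a power 2^t_j costs less than a factor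
   2 per coordinate, and outside the cross the exponents t_j sum to more than m. *)
Lemma notin_Qcross_rw_ge k : (0 < d)%N -> ~ Qcross alpha gam m k ->
  2 `^ (m%:R - d%:R + 1) <= rw alpha gam k.
Proof.
move=> d0 nk.
have /choice[t ht] := fun i => ex_dyadic_ceil (r1_ge1 alpha (gam i) (tnth k i)).
have mt : (m < \sum_(i < d) t i)%N.
  rewrite ltnNge; apply/negP => tm; apply: nk.
  pose i0 := Ordinal d0.
  (* If the exponents summed to at most m, giving the missing amount to one coordinate would put k
     in the cross. *)
  exists (fun i => t i + (if i == i0 then m - \sum_(i < d) t i else 0))%N; split.
    by rewrite big_split /= -big_mkcond big_pred1_eq subnKC.
  move=> i; have [ti _] := andP (ht i); apply: le_trans ti _.
  by rewrite ler_weXn2l ?ler1n// leq_addr.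
have P : 2 ^+ (\sum_(i < d) t i)%N <= 2 ^+ d * rw alpha gam k.
  have -> : (2 : R) ^+ d = \prod_(i < d) 2 by rewrite prodr_const card_ord.
  rewrite expr_sum /rw -big_split; apply: ler_prod => i _.
  by have [_ /ltW ->] := andP (ht i); rewrite exprn_ge0.
(* The exponents sum to at least m + 1, which is where the summand 1 comes from; the loss 2^d comes
   from rounding. *)
rewrite (_ : m%:R - d%:R + 1 = m.+1%:R - d%:R); last by rewrite -natr1; ring.
rewrite powRB; last by rewrite pnatr_eq0 implybT.
rewrite !powR_mulrn// ler_pdivrMr ?exprn_gt0// mulrC.
by apply: le_trans P; rewrite ler_weXn2l ?ler1n.
Qed.

Lemma sum_Qcross_rw_le (beta delta : R) (s : seq (d.-tuple int)) :
  0 < beta -> 0 < delta -> 2 * (alpha - beta) = 1 + 2 * delta ->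
  uniq s -> (forall k, k \in s -> Qcross alpha gam m k) ->
  \sum_(k <- s) rw beta gam k <= 2 ^+ m * (1 + 2 * zeta (1 + 2 * delta)) ^+ d.
Proof.
move=> b0 d0 abd us sQ.
have ba : beta <= alpha by lra.
have z1 : 1 < 1 + 2 * delta by lra.
apply: (@le_trans _ _ (\sum_(k <- s) 2 ^+ m *
    \prod_(i < d) zeta_weight (1 + 2 * delta) (tnth k i))).
  rewrite big_seq [leRHS]big_seq; apply: ler_sum => k ks.
  apply: le_trans (rw_decay b0 ba k) _; rewrite abd ler_wpM2r//.
    by apply: prodr_ge0 => i _; exact: zeta_weight_ge0.
  exact: Qcross_rw_le (sQ _ ks).
rewrite -mulr_sumr ler_wpM2l ?exprn_ge0//.
exact: sum_prod_zeta_weight.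
Qed.

End HyperbolicCross.
End ProductWeights.

(** * Cauchy-Schwarz, infinite sums, and the Wiener and Sobolev norms *)

Lemma weighted_Cauchy_Schwarz (R : realFieldType) I (s : seq I) (w x : I -> R) :
  (forall i, 0 < w i) -> (forall i, 0 <= x i) ->
  (\sum_(i <- s) x i) ^+ 2 <=
  (\sum_(i <- s) w i * x i) * (\sum_(i <- s) x i / w i).
Proof.
move=> w0 x0; elim: s => [|i s ih]; first by rewrite !big_nil expr0n mulr0.
rewrite !big_cons.
(* The cross terms of the induction step reduce to w_i/w_j + w_j/w_i >= 2, that is, to (w_i - w_j)^2
   >= 0. *)
have : 2 * \sum_(j <- s) x j <=
    w i * (\sum_(j <- s) x j / w j) + (\sum_(j <- s) w j * x j) / w i.
  rewrite !mulr_sumr mulr_suml -big_split /=; apply: ler_sum => j _.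
  rewrite -subr_ge0.
  have -> : w i * (x j / w j) + w j * x j / w i - 2 * x j =
      x j * (w i - w j) ^+ 2 / (w i * w j).
    by field; rewrite !gt_eqF.
  by apply: divr_ge0; apply: mulr_ge0 => //; rewrite ?sqr_ge0// ltW.
move: ih.
set S := \sum_(j <- s) x j; set U := \sum_(j <- s) _ ; set V := \sum_(j <- s) _.
move=> SUV H.
have -> : (w i * x i + U) * (x i / w i + V) =
    x i ^+ 2 + x i * (w i * V + U / w i) + U * V.
  by field; rewrite gt_eqF.
rewrite sqrrD -mulr_natr lerD// lerD2l -mulrA ler_wpM2l// mulrC.
exact: H.
Qed.

Lemma ler_sum_esum (R : realType) (T : choiceType) (F : T -> R) (s : seq T) :
  uniq s -> ((\sum_(k <- s) F k)%:E <= \esum_(k in [set: T]) (F k)%:E)%E.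
Proof.
move=> us; apply: esum_ge; exists [set` s] => //.
by rewrite -fsbig_seq// sumEFin.
Qed.

Lemma esum_le_seq (R : realType) (T : choiceType) (F : T -> R) (B : R) :
  (forall s : seq T, uniq s -> \sum_(k <- s) F k <= B) ->
  (\esum_(k in [set: T]) (F k)%:E <= B%:E)%E.
Proof.
move=> FB; apply: ge_ereal_sup => _ [S [finS _] <-].
by rewrite fsbig_finite// sumEFin lee_fin; apply: FB; exact: finmap.fset_uniq.
Qed.

Section WienerAlgebraNorm.
Variables (R : realType) (d : nat) (alpha : R) (gam : 'I_d -> R).
Variable g : d.-tuple R -> R[i].
Hypothesis gA : (normA alpha gam g < +oo)%E.
Let A := fine (normA alpha gam g).

(** The Wiener norm enters all later estimates in this finite form; [fineK] is legitimate because
    the [esum] is nonnegative and finite. *)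
Lemma sum_normA_le (s : seq (d.-tuple int)) : uniq s ->
  \sum_(k <- s) Num.sqrt (rw alpha gam k) * cabs (fhat g k) <= A.
Proof.
move=> us; rewrite -lee_fin /A fineK; first exact: ler_sum_esum.
rewrite ge0_fin_numE//; apply: esum_ge0 => k _.
by rewrite lee_fin mulr_ge0 ?sqrtr_ge0 ?cabs_ge0.
Qed.

Lemma normA_ge0 : 0 <= A.
Proof. by have := @sum_normA_le [::] isT; rewrite big_nil. Qed.

Lemma sqrt_rw_ge1 (k : d.-tuple int) : 1 <= Num.sqrt (rw alpha gam k).
Proof. by rewrite -[leLHS]sqrtr1 ler_wsqrtr// rw_ge1. Qed.

Lemma sum_fhat_le (s : seq (d.-tuple int)) : uniq s ->
  \sum_(k <- s) cabs (fhat g k) <= A.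
Proof.
move=> us; apply: le_trans (sum_normA_le us); apply: ler_sum => k _.
by rewrite ler_peMl ?cabs_ge0 ?sqrt_rw_ge1.
Qed.

Section SobolevNorm.
Variable beta : R.
Hypotheses (b0 : 0 < beta) (ba : beta <= alpha).
Hypothesis gam01 : forall j, 0 < gam j <= 1.
Hypothesis gF : fourier_rep g.
Variables (s : seq (d.-tuple int)) (p : d.-tuple int -> R[i]) (P : R).
Hypotheses (us : uniq s) (pP : forall h, cabs (p h) <= P).

Let w k : R := Num.sqrt (rw alpha gam k).
Let a k : R := cabs (fhat g k).

Let P0 : 0 <= P.
Proof. exact: le_trans (cabs_ge0 _) (pP [tuple 0 | i < d]). Qed.

Let w0 k : 0 < w k. Proof. exact: lt_le_trans (sqrt_rw_ge1 k). Qed.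

Let sum_shift_le (t : seq (d.-tuple int)) h : uniq t ->
  \sum_(k <- t) w (addk k h) * a (addk k h) <= A.
Proof.
move=> ut; rewrite -(big_map (fun k => addk k h) xpredT (fun k => w k * a k)).
by apply: sum_normA_le; rewrite map_inj_uniq//; exact: addkI.
Qed.

Let addkC (k h : d.-tuple int) : addk k h = addk h k.
Proof. by apply: eq_from_tnth => i; rewrite !tnth_addk addrC. Qed.

Lemma fhat_mul_trig_sqr_le k :
  cabs (fhat (fun x => g x * \sum_(h <- s) p h * omegabar h x) k) ^+ 2 <=
  P ^+ 2 * (A * \sum_(h <- s) a (addk k h) / w (addk k h)).
Proof.
rewrite (fhat_mul_trig sum_fhat_le gF).
apply: (@le_trans _ _ ((P * \sum_(h <- s) a (addk k h)) ^+ 2)).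
  rewrite lerXn2r ?nnegrE ?cabs_ge0//.
    by rewrite mulr_ge0// sumr_ge0// => h _; exact: cabs_ge0.
  rewrite (le_trans (cabs_sum _ _ _))// mulr_sumr; apply: ler_sum => h _.
  by rewrite cabsM ler_wpM2r ?cabs_ge0.
rewrite exprMn ler_wpM2l ?sqr_ge0//.
apply: le_trans (weighted_Cauchy_Schwarz _ (w := fun h => w (addk k h)) _ _) _ => //.
  by move=> h; exact: cabs_ge0.
apply: ler_wpM2r.
  by apply: sumr_ge0 => h _; rewrite divr_ge0 ?cabs_ge0// ltW.
(* Here k is fixed and h varies, so this is a piece of the norm series translated by k. *)
under eq_bigr do rewrite addkC.
exact: sum_shift_le.
Qed.

Lemma normH2_mul_trig_le :
  (normH2 beta gam (fun x => g x * \sum_(h <- s) p h * omegabar h x)%R <=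
   (P ^+ 2 * A ^+ 2 * cagd alpha gam ^+ 2 * \sum_(h <- s) rw beta gam h)%:E)%E.
Proof.
apply: esum_le_seq => t ut.
apply: (@le_trans _ _ (\sum_(k <- t) \sum_(h <- s) P ^+ 2 * A *
    cagd alpha gam ^+ 2 * rw beta gam h * (w (addk k h) * a (addk k h)))).
  apply: ler_sum => k _.
  apply: le_trans (ler_wpM2l (rw_ge0 _ _ _) (fhat_mul_trig_sqr_le k)) _.
  rewrite !mulr_sumr; apply: ler_sum => h _.
  (* Of the two factors w in r_alpha(k+h), one cancels the division by w and the other restores a
     summand of the Wiener norm. *)
  have rwE : rw alpha gam (addk k h) = w (addk k h) ^+ 2.
    by rewrite sqr_sqrtr// rw_ge0.
  have -> : P ^+ 2 * A * cagd alpha gam ^+ 2 * rw beta gam h *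
      (w (addk k h) * a (addk k h)) =
      cagd alpha gam ^+ 2 * rw alpha gam (addk k h) * rw beta gam h *
      (P ^+ 2 * (A * (a (addk k h) / w (addk k h)))).
    by rewrite rwE; field; rewrite gt_eqF.
  rewrite ler_wpM2r ?rw_shift//.
  by rewrite !mulr_ge0 ?sqr_ge0 ?normA_ge0 ?cabs_ge0// invr_ge0 ltW.
(* With the sums exchanged, the inner sum over k at fixed h is again a translated piece of the norm
   series, which gives the second factor [A]. *)
rewrite exchange_big mulr_sumr; apply: ler_sum => h _ /=.
rewrite -mulr_sumr.
have -> : P ^+ 2 * A ^+ 2 * cagd alpha gam ^+ 2 * rw beta gam h =
  P ^+ 2 * A * cagd alpha gam ^+ 2 * rw beta gam h * A by ring.
rewrite ler_wpM2l ?sum_shift_le//.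
by rewrite !mulr_ge0 ?exprn_ge0 ?normA_ge0 ?rw_ge0 ?sqrtr_ge0.
Qed.

End SobolevNorm.
End WienerAlgebraNorm.

(** * The compressed data weights and their trigonometric polynomial *)

Section Compression.
Variables (R : realType) (d N : nat) (X : 'I_N -> d.-tuple R) (c : 'I_N -> R).

Lemma muN_ge0 : 0 <= muN c.
Proof. by rewrite mulr_ge0 ?invr_ge0// sumr_ge0. Qed.

Lemma cabs_phicheck_le k : cabs (phicheck X c k) <= muN c.
Proof.
rewrite cabsM cabsV cabs_nat ler_wpM2l ?invr_ge0// (le_trans (cabs_sum _ _ _))//.
by apply: ler_sum => n _; rewrite cabsM cabs_omega cabs_real mulr1.
Qed.

Lemma phiKE K : finite_set K -> phiK X c K =
  fun x => \sum_(k <- finmap.enum_fset (fset_set K)) phicheck X c k * omegabar k x.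
Proof. by move=> Kfin; apply: funext => x; rewrite /phiK fsbig_finite. Qed.

End Compression.

(** * The two error terms *)

Section Errors.
Variables (R : realType) (d N : nat) (X : 'I_N -> d.-tuple R) (c : 'I_N -> R).
Variables (alpha : R) (gam : 'I_d -> R) (g : d.-tuple R -> R[i]) (m : nat).
Hypothesis alpha1 : 1 < alpha.
Hypothesis d0 : (0 < d)%N.
Hypothesis gam01 : forall j, 0 < gam j <= 1.
Hypothesis gA : inA alpha gam g.
Hypothesis gF : fourier_rep g.
Hypothesis X01 : forall n, cube d (X n).

Let K := Qcross alpha gam m.
Let A := fine (normA alpha gam g).
Let Kfin : finite_set K := finite_Qcross gam01 m alpha1.
Let s : seq (d.-tuple int) := finmap.enum_fset (fset_set K).

Let us : uniq s. Proof. exact: finmap.fset_uniq. Qed.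

Let sK k : k \in s -> K k.
Proof. by rewrite in_fset_set// => /set_mem. Qed.

Let A_ge0 : 0 <= A. Proof. exact: normA_ge0 gA.2. Qed.

Let sgA := sum_fhat_le gA.2.

Lemma err1_le : err1 X c K g <=
  A * (Num.sqrt (2 `^ (m%:R - d%:R + 1)))^-1 * muN c.
Proof.
rewrite /err1 phiKE// (cintC_mul_trig sgA gF).
(* Expanding [g] in its Fourier series at the points [X n] and exchanging the finite sums exhibits
   the data average as a limit over boxes. The integral is the part of that series over the cross,
   so only the tail remains. *)
have H : cvgC (fun M => \sum_(k <- box d M) phicheck X c k * fhat g k)
    (N%:R^-1 * \sum_(n < N) ((c n)%:C)%C * g (X n)).
  have -> : (fun M => \sum_(k <- box d M) phicheck X c k * fhat g k) =
      (fun M => N%:R^-1 * \sum_(n < N) ((c n)%:C)%C * fsum g (box d M) (X n)).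
    apply: funext => M; under eq_bigr do rewrite /phicheck -mulrA mulr_suml.
    rewrite -mulr_sumr exchange_big /=; congr (_ * _).
    apply: eq_bigr => n _; rewrite mulr_sumr; apply: eq_bigr => k _; ring.
  by apply: cvgCZ; apply: cvgC_sum => n; apply: cvgCZ; exact: fsum_box_cvg.
have := cvgCD H (cvgC_cst (- \sum_(k <- s) phicheck X c k * fhat g k)).
move=> /cvgC_cabs_le; apply.
have [M0 sM0] := seq_sub_box s.
near=> M.
have sM : {subset s <= box d M}.
  move=> k /sM0; apply: box_sub; near: M; exact: nbhs_infty_ge.
rewrite (sum_subset _ us (box_uniq d M) sM) addrAC subrr add0r.
rewrite (le_trans (cabs_sum _ _ _))//.
set q := Num.sqrt _.
have q0 : 0 < q by rewrite sqrtr_gt0 powR_gt0.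
(* Outside the cross, [q] is at most the square root of r_alpha(k), so inserting the quotient of the
   two only enlarges each term. *)
apply: (@le_trans _ _ (\sum_(k <- box d M | k \notin s)
    q^-1 * muN c * (Num.sqrt (rw alpha gam k) * cabs (fhat g k)))).
  apply: ler_sum => k ks; rewrite cabsM mulrA ler_wpM2r ?cabs_ge0//.
  rewrite mulrAC (le_trans (cabs_phicheck_le X c k))// ler_peMl ?muN_ge0//.
  rewrite mulrC ler_pdivlMr// mul1r ler_wsqrtr//.
  apply: notin_Qcross_rw_ge => // Kk.
  by move: ks; rewrite in_fset_set// notin_setE.
rewrite -mulr_sumr -[leRHS]mulrA [leRHS]mulrC ler_wpM2l//.
  by rewrite mulr_ge0 ?muN_ge0// invr_ge0 ltW.
rewrite -big_filter; apply: sum_normA_le gA.2 _ _.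
exact/filter_uniq/box_uniq.
Unshelve. all: by end_near. Qed.

Section LatticeRule.
Variables (beta delta : R) (L : nat) (gv : 'I_d -> nat) (E : R).
Hypotheses (b0 : 0 < beta) (delta0 : 0 < delta).
Hypothesis abd : 2 * (alpha - beta) = 1 + 2 * delta.
Hypothesis wceE : (wce beta gam L gv <= E%:E)%E.

(** An upper bound for the H_beta norm of the product of [g] with [phiK]; [sqrB] puts its square in
    the shape produced by [normH2_mul_trig_le] and [sum_Qcross_rw_le]. *)
Let B : R := A * Num.sqrt (2 ^+ m) * cagd alpha gam * zetadd delta d * muN c.

Let B_ge0 : 0 <= B.
Proof. by rewrite mulr_ge0 ?muN_ge0// !mulr_ge0 ?A_ge0 ?sqrtr_ge0 ?powR_ge0. Qed.

Let sqrB : B ^+ 2 = muN c ^+ 2 * A ^+ 2 * cagd alpha gam ^+ 2 *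
  (2 ^+ m * (1 + 2 * zeta (1 + 2 * delta)) ^+ d).
Proof.
have z1 : 1 < 1 + 2 * delta by move: delta0; lra.
have z0 : 0 <= 1 + 2 * zeta (1 + 2 * delta).
  by rewrite addr_ge0// mulr_ge0// zeta_ge0.
rewrite /B !exprMn sqr_sqrtr ?exprn_ge0//.
have -> : zetadd delta d ^+ 2 = (1 + 2 * zeta (1 + 2 * delta)) ^+ d.
  rewrite /zetadd -powR_mulrn ?powR_ge0// -powRrM -[in RHS]powR_mulrn//.
  by congr (_ `^ _); field.
by ring.
Qed.

(** The worst-case error concerns the unit ball, so the product is divided by B'; a strict bound
    avoids dividing by 0 when B = 0. The scaling is absorbed into the coefficients [p], so the
    product with a trigonometric polynomial keeps its form. *)
Let err2_scaled B' : B < B' -> err2 X c K g L gv <= B' * E.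
Proof.
move=> BB'; have B'0 : 0 < B' by exact: le_lt_trans BB'.
pose p k := ((B'^-1)%:C)%C * phicheck X c k.
pose f x := g x * \sum_(h <- s) p h * omegabar h x.
have fE x : f x = ((B'^-1)%:C)%C * (g x * phiK X c K x).
  rewrite /f phiKE// mulrCA; congr (_ * _); rewrite mulr_sumr.
  by apply: eq_bigr => h _; rewrite mulrA.
have pP h : cabs (p h) <= B'^-1 * muN c.
  rewrite cabsM cabs_real gtr0_norm ?invr_gt0//.
  by rewrite ler_wpM2l ?invr_ge0 ?(ltW B'0)// cabs_phicheck_le.
have ba : beta <= alpha by move: abd delta0; lra.
have fH : unitH beta gam f.
  split; first by apply: (in_L2_mul_trig sgA gF); [exact: gA.1.1|exact: gA.1.2.1].
  split; last exact: (fourier_rep_mul_trig sgA gF).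
  apply: le_trans (normH2_mul_trig_le gA.2 b0 ba gam01 gF us pP) _.
  rewrite lee_fin.
  apply: (@le_trans _ _ (B'^-1 ^+ 2 * B ^+ 2)).
    set C := B'^-1 * muN c * A * cagd alpha gam.
    rewrite sqrB -/A.
    have -> : (B'^-1 * muN c) ^+ 2 * A ^+ 2 * cagd alpha gam ^+ 2 = C ^+ 2.
      by rewrite -!exprMn.
    set Z := 2 ^+ m * _; have -> : B'^-1 ^+ 2 * (muN c ^+ 2 * A ^+ 2 *
        cagd alpha gam ^+ 2 * Z) = C ^+ 2 * Z by rewrite /C; ring.
    rewrite ler_wpM2l ?sqr_ge0//; exact: (sum_Qcross_rw_le gam01 b0 delta0 abd us sK).
  have q0 : 0 <= B'^-1 * B by apply: mulr_ge0 => //; rewrite invr_ge0 ltW.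
  rewrite -exprMn expr_le1//.
  by rewrite mulrC ler_pdivrMr// mul1r ltW.
have : cabs (cintC f - lattice_rule L gv f) <= E.
  rewrite -lee_fin; apply: le_trans wceE.
  by apply: ereal_sup_ubound; exists f; [exact: fH|].
have bphi : bucontC (fun x => g x * phiK X c K x).
  by rewrite phiKE//; exact: (bucontC_mul_trig sgA gF).
have -> : cintC f = ((B'^-1)%:C)%C * cintC (fun x => g x * phiK X c K x).
  by rewrite -cintCZ//; congr cintC; apply: funext => x; exact: fE.
have -> : lattice_rule L gv f =
    ((B'^-1)%:C)%C * lattice_rule L gv (fun x => g x * phiK X c K x).
  rewrite /lattice_rule mulrCA; congr (_ * _); rewrite mulr_sumr.
  by apply: eq_bigr => l _; exact: fE.
rewrite -mulrBr cabsM cabs_real gtr0_norm ?invr_gt0//.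
by rewrite mulrC ler_pdivrMr// [leRHS]mulrC.
Qed.

Lemma err2_le : err2 X c K g L gv <= B * E.
Proof.
have E0 : 0 <= E.
  have BB1 : B < B + 1 by rewrite ltrDl.
  have := le_trans (cabs_ge0 _) (err2_scaled BB1).
  by rewrite pmulr_rge0// ltr_wpDl.
apply/ler_addgt0Pr => e e0.
have E1 : 0 < E + 1 by rewrite ltr_wpDl.
(* The excess e/(E+1) costs at most e after multiplication by E, and E + 1 is positive even if E =
   0. *)
apply: le_trans (err2_scaled (_ : B < B + e / (E + 1))) _.
  by rewrite ltrDl divr_gt0.
by rewrite mulrDl lerD2l mulrAC ler_pdivrMr// ler_pM2l// lerDl ler01.
Qed.

End LatticeRule.
End Errors.

Theorem theorem3p20 (R : realType) (alpha delta tau : R) (d : nat)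
    (gam : 'I_d -> R) (g : d.-tuple R -> R[i])
    (N : nat) (X : 'I_N -> d.-tuple R) (c : 'I_N -> R)
    (L : nat) (gv : 'I_d -> nat) (m : nat) :
  1 < alpha ->
  0 < delta -> delta < alpha - 1 ->
  0 < tau -> tau <= alpha - 1 - delta ->
  (0 < d)%N ->
  (forall j : 'I_d, 0 < gam j <= 1) ->
  (forall i j : 'I_d, (i <= j)%N -> gam j <= gam i) ->
  inA alpha gam g -> fourier_rep g ->
  (0 < N)%N ->
  (forall n, cube d (X n)) ->
  prime L ->
  (forall j, (1 <= gv j <= L - 1)%N) ->
  (forall tau' : R, 0 < tau' -> tau' <= (alpha - 2^-1 - delta) - 2^-1 ->
     (wce (alpha - 2^-1 - delta) gam L gv
      <= (Cgd gam (alpha - 2^-1 - delta) tau'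
          * L%:R `^ (- (alpha - 2^-1 - delta) + tau'))%:E)%E) ->
  (0 < m)%N ->
  let K := Qcross alpha gam m in
  cabs ((N%:R)^-1 * \sum_(n < N) ((c n)%:C)%C * g (X n)
        - (L%:R)^-1 * \sum_(l < L) g (lattice_pt L gv l) * phiK X c K (lattice_pt L gv l))
  <= err1 X c K g + err2 X c K g L gv /\
  err1 X c K g + err2 X c K g L gv
  <= fine (normA alpha gam g)
     * ((Num.sqrt (2 `^ (m%:R - d%:R + 1)))^-1
        + Num.sqrt (2 ^+ m) / L%:R `^ (alpha - 2^-1 - delta - tau)
          * cagd alpha gam * zetadd delta d
          * Cgd gam (alpha - 2^-1 - delta) tau)
     * muN c.
Proof.
move=> alpha1 delta0 delta1 tau0 tau1 d0 gam01 _ gA gF _ X01 _ _ wceE _ K; split.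
  (* Triangle inequality through the exact integral [I]. *)
  rewrite /err1 /err2 /lattice_rule.
  set I := cintC _; set u := (X in X - _); set v := (X in _ - X).
  by rewrite -[u - v](_ : (u - I) + (I - v) = _) ?cabsD// addrA subrK.
set beta := alpha - 2^-1 - delta.
(* As beta - 1/2 = alpha - 1 - delta, the given tau is an admissible choice in the lattice
   hypothesis, and tau > 0 forces beta > 0. *)
have tb : tau <= beta - 2^-1 by rewrite /beta; lra.
have b0 : 0 < beta by lra.
have abd : 2 * (alpha - beta) = 1 + 2 * delta by rewrite /beta; field.
rewrite mulrDr mulrDl lerD//; first exact: err1_le.
apply: le_trans (err2_le X c m alpha1 gam01 gA gF b0 delta0 abd (wceE _ tau0 tb)) _.
rewrite -/beta (_ : - beta + tau = - (beta - tau)); last by ring.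
(* What is left is an equality: the power of L with exponent -(beta - tau) is the inverse power in
   the claim, kept as an atom for [ring]. *)
rewrite powRN le_eqVlt; apply/orP; left; apply/eqP.
set P := (_ `^ _)^-1; ring.
Qed.
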